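(* Let $(e_i)_{i\in\mathbb N}$ be an unconditional and democratic basis of a (real) Banach space $X$. For any $\varepsilon>0$ there is an equivalent norm on $X$ with respect to which $(e_i)$ is normalized, $1$-unconditional and $(1+\varepsilon)$-democratic.
   Context: $\mathbb N=\{1,2,\dots\}$. Bases are Schauder bases indexed by $\mathbb N$ and are assumed seminormalized: $0<\inf_i\|e_i\|\le\sup_i\|e_i\|<\infty$. The basis is normalized if $\|e_i\|=1$ for all $i$. The basis is $K$-unconditional if $\|\sum a_ie_i\|\le K\|\sum b_ie_i\|$ whenever $|a_i|\le|b_i|$ for all $i$; it is unconditional if it is $K$-unconditional for some $K$. The basis is $\Delta$-democratic (for $\Delta\ge1$) if $\|\sum_{i\in A}e_i\|\le\Delta\|\sum_{i\in B}e_i\|$ for all finite $A,B\subset\mathbb N$ with $|A|\le|B|$; it is democratic if it is $\Delta$-democratic for some $\Delta$. *)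

(* Defs.v *)
From HB Require Import structures.
From mathcomp Require Import all_boot all_order all_algebra finmap.
From mathcomp Require Import all_classical all_reals all_analysis.

Set Implicit Arguments.
Unset Strict Implicit.
Unset Printing Implicit Defensive.

Import Order.TTheory GRing.Theory Num.Theory.
Import numFieldNormedType.Exports.

Local Open Scope classical_set_scope.
Local Open Scope ring_scope.

(* Sequences are indexed by nat, starting at 0 instead of 1.

   The geometric notions take the norm as an argument [N : X -> R], because
   they are used both for the given norm of X and for an equivalent one.
   Convergence is always in the topology of X; equivalent norms induce that
   same topology, so being a Schauder basis does not depend on N. *)

Section Bases.
Context {R : realType} {X : normedModType R}.
Implicit Types (N : X -> R) (e : nat -> X) (a b : nat -> R).

Definition is_norm N : Prop :=
  [/\ forall x, N x = 0 -> x = 0,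
      forall (c : R) x, N (c *: x) = `|c| * N x
    & forall x y, N (x + y) <= N x + N y].

Definition equivalent_norm N : Prop :=
  is_norm N /\
  exists c C : R,
    [/\ 0 < c, 0 < C & forall x, c * `|x| <= N x /\ N x <= C * `|x|].

Definition expansion e a (x : X) : Prop :=
  series (fun i => a i *: e i) @ \oo --> x.

Definition schauder_basis e : Prop :=
  forall x, exists! a, expansion e a x.

Definition seminormalized N e : Prop :=
  (0 < ereal_inf (range (fun i => (N (e i))%:E)))%E /\
  (ereal_sup (range (fun i => (N (e i))%:E)) < +oo)%E.

Definition normalized N e : Prop := forall i, N (e i) = 1.

(* The sums may be infinite, provided they converge. *)
Definition K_unconditional N e (K : R) : Prop :=
  forall a b x y, expansion e a x -> expansion e b y ->
    (forall i, `|a i| <= `|b i|) -> N x <= K * N y.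

Definition unconditional N e : Prop := exists K, K_unconditional N e K.

Definition D_democratic N e (D : R) : Prop :=
  1 <= D /\
  forall A B : {fset nat}, (#|` A| <= #|` B|)%N ->
    N (\sum_(i <- A) e i) <= D * N (\sum_(i <- B) e i).

Definition democratic N e : Prop := exists D, D_democratic N e D.

End Bases.

(* Main.v *)
Require Import Defs.
From HB Require Import structures.
From mathcomp Require Import all_boot all_order all_algebra finmap.
From mathcomp Require Import all_classical all_reals all_analysis.
From mathcomp Require Import zify ring lra.

Set Implicit Arguments.
Unset Strict Implicit.
Unset Printing Implicit Defensive.

Import Order.TTheory GRing.Theory Num.Theory.
Import numFieldNormedType.Exports.

Local Open Scope classical_set_scope.
Local Open Scope ring_scope.

(** The new norm interpolates between a large multiple of the old one and the
    Lorentz-type norm whose unit ball is the convex hull of the vectors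
    [(phi |E|)^-1 *: \sum_(i <- E) (+- e i)], where [phi] plays the role of the
    fundamental function. Write [1_B] for [\sum_(i <- B) e i].

    The function [phi] is chosen nondecreasing, with [phi n / n] nonincreasing
    and [phi 1 = 1], and with [phi |B|] comparable to [|1_B|]
    ([exists_quasi_concave_fundamental]). The norm [renorm x] is the infimum of
      [C * \sum_j |y_j| + \sum_k |t_k| * phi |E_k|]
    over all finite families such that the coefficients of [x] are dominated by
    the sum of those of the [y_j] and of the step functions [t_k 1_(E_k)].
    Stating the decomposition as a domination makes the norm [1]-unconditional
    at once.

    It is at most [C * |x|]; it is at least a multiple of [|x|] because the
    original norm controls dominated sums ([norm_dominated]) and [1_E] has norm
    at most a multiple of [phi |E|]. Clearly [renorm 1_B <= phi |B|]. The heart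
    of the matter is the converse [(1 - eta) * phi |B| <= renorm 1_B] when [C]
    is large ([renorm_fset_ge]). In a decomposition of [1_B], split [B] into
    the part [B'] where the [y_j] contribute at least [eta] and the rest.
    On the rest the step functions cover at least [1 - eta], hence cost at least
    [(1 - eta) * phi |B \ B'|] ([cover_cost_ge]). On [B'] the [y_j] dominate
    [eta 1_(B')], so that their norms add up to a multiple of
    [eta * |1_(B')|], and [C] is chosen to make this worth [phi |B'|].
    Subadditivity of [phi] adds up the two parts. The same two inequalities
    pinch [renorm 1_B] between [(1 - eta) * phi |B|] and [phi |B|], which is
    [(1 + eps)]-democracy for [eta = eps / (1 + eps)]; and for a single basis
    vector the bound is sharp, whence [renorm (e i) = 1] ([renorm_basis]). *)

(** * Expansions and dominated sums *)

Lemma expansionD (R : realType) (X : normedModType R) (e : nat -> X) a b x y :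
  expansion e a x -> expansion e b y -> expansion e (a \+ b) (x + y).
Proof.
rewrite /expansion => ax bx.
have -> : series (fun i => (a \+ b) i *: e i) =
    series (fun i => a i *: e i) + series (fun i => b i *: e i).
  apply/funext => n; rewrite fctE /series /= -big_split /=.
  by apply: eq_bigr => i _; rewrite scalerDl.
exact: cvgD.
Qed.

Lemma expansionZ (R : realType) (X : normedModType R) (e : nat -> X) c a x :
  expansion e a x -> expansion e (fun i => c * a i) (c *: x).
Proof.
rewrite /expansion => ax.
have -> : series (fun i => c * a i *: e i) =
    c \*: series (fun i => a i *: e i).
  apply/funext => n; rewrite /series /= scaler_sumr.
  by apply: eq_bigr => i _; rewrite scalerA.
exact: cvgZl_tmp.
Qed.

Lemma expansion_basis (R : realType) (X : normedModType R) (e : nat -> X) i :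
  expansion e (fun j => (j == i)%:R) (e i).
Proof.
rewrite /expansion; apply: cvg_near_cst; exists i.+1 => // n /= lt_in.
rewrite /series /= big_mkord (bigD1 (Ordinal lt_in)) //= eqxx scale1r.
rewrite big1 ?addr0 // => j /negPf ji.
by move: ji; rewrite -val_eqE /= => ->; rewrite scale0r.
Qed.

Lemma riesz_decomposition (R : realDomainType) (t u v : R) :
  0 <= u -> 0 <= v -> `|t| <= u + v ->
  exists t1 t2, [/\ t = t1 + t2, `|t1| <= u & `|t2| <= v].
Proof.
move=> u0 v0; rewrite ler_norml => /andP[tl tr].
have [ut|ut] := leP u t.
  by exists u, (t - u); rewrite !ler_norml; split; try lra; apply/andP; lra.
have [tu|tu] := leP t (- u).
  by exists (- u), (t + u); rewrite !ler_norml; split; try lra; apply/andP; lra.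
by exists t, 0; rewrite !ler_norml; split; try lra; apply/andP; lra.
Qed.

Section Coordinates.
Context (R : realType) (X : normedModType R) (e : nat -> X).
Context (coef : X -> nat -> R).
Context (coefP : forall x, expansion e (coef x) x).
Context (coef_uniq : forall a x, expansion e a x -> a = coef x).

Lemma coefD x y i : coef (x + y) i = coef x i + coef y i.
Proof. by rewrite -(coef_uniq (expansionD (@coefP x) (@coefP y))). Qed.

Lemma coefZ c x i : coef (c *: x) i = c * coef x i.
Proof. by rewrite -(coef_uniq (@expansionZ _ _ _ c _ _ (@coefP x))). Qed.

Lemma coef_basis i j : coef (e i) j = (j == i)%:R.
Proof. by rewrite -(coef_uniq (@expansion_basis _ _ e i)). Qed.

Lemma coef_sum (s : seq nat) (F : nat -> X) j :
  coef (\sum_(i <- s) F i) j = \sum_(i <- s) coef (F i) j.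
Proof.
elim: s => [|i s IHs]; last by rewrite !big_cons coefD IHs.
by rewrite !big_nil -(scale0r (0 : X)) coefZ mul0r.
Qed.

Lemma coef_fset (E : {fset nat}) j :
  coef (\sum_(i <- E) e i) j = (j \in E)%:R.
Proof.
rewrite coef_sum; under eq_bigr do rewrite coef_basis.
have [jE|jE] := boolP (j \in E).
  rewrite (bigD1_seq j) ?fset_uniq //= eqxx big1 ?addr0 // => i /negPf.
  by rewrite eq_sym => ->.
rewrite big_seq big1 // => i iE; case: eqP => // ji.
by rewrite ji iE in jE.
Qed.

Lemma coef_partial n (a : nat -> R) j :
  coef (\sum_(0 <= i < n) a i *: e i) j = if (j < n)%N then a j else 0.
Proof.
rewrite coef_sum; under eq_bigr do rewrite coefZ coef_basis.
case: ifP => jn.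
  rewrite (bigD1_seq j) ?mem_index_iota ?iota_uniq //= eqxx mulr1.
  by rewrite big1 ?addr0 // => i /negPf; rewrite eq_sym => ->; rewrite mulr0.
rewrite big_seq big1 // => i; rewrite mem_index_iota /= => lt_in.
by case: eqP => [ji|_]; [rewrite ji lt_in in jn | rewrite mulr0].
Qed.

Context (K : R).
Context (unc : K_unconditional (fun x : X => `|x|) e K).

Lemma norm_le_coef x y :
  (forall i, `|coef x i| <= `|coef y i|) -> `|x| <= K * `|y|.
Proof. exact: unc. Qed.

(** Unconditionality compares two vectors; here one vector is compared with a
    sum of absolute values. Each coefficient of [x] is split along the summands,
    and this is done on partial sums, for which the pieces are finite
    combinations: no convergence of the infinite pieces has to be shown. *)
Lemma norm_dominated x (ys : seq X) :
  (forall i, `|coef x i| <= \sum_(y <- ys) `|coef y i|) ->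
  `|x| <= K * \sum_(y <- ys) `|y|.
Proof.
move=> dom.
have S n : `|\sum_(0 <= i < n) coef x i *: e i| <= K * \sum_(y <- ys) `|y|.
  move: (coef x) dom => {x}.
  elim: ys => [|y ys IHys] a dom.
    rewrite big_nil mulr0 big1 ?normr0 // => i _.
    by move: (dom i); rewrite big_nil normr_le0 => /eqP ->; rewrite scale0r.
  have {}dom i : exists t, `|t.1| <= `|coef y i| /\
      (`|t.2| <= \sum_(z <- ys) `|coef z i|) /\ a i = t.1 + t.2.
    have [] := @riesz_decomposition R (a i) `|coef y i|
      (\sum_(z <- ys) `|coef z i|).
    - by [].
    - exact: sumr_ge0.
    - by have := dom i; rewrite big_cons.
    by move=> t1 [t2 [? ? ?]]; exists (t1, t2).
  have [t tP] := choice dom.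
  have -> : \sum_(0 <= i < n) a i *: e i =
      \sum_(0 <= i < n) (t i).1 *: e i + \sum_(0 <= i < n) (t i).2 *: e i.
    rewrite -big_split /=; apply: eq_bigr => i _.
    by have [_ [_ ->]] := tP i; rewrite scalerDl.
  rewrite big_cons mulrDr (le_trans (ler_normD _ _)) // lerD //.
    apply: norm_le_coef => i; rewrite coef_partial; case: ifP => _.
      by have [] := tP i.
    by rewrite normr0.
  by apply: IHys => i; have [_ []] := tP i.
apply: (cvgr_to_le (cvg_norm (@coefP x))); near=> n.
exact: S.
Unshelve. all: by end_near.
Qed.

End Coordinates.

(** * Quasi-concave functions *)

Definition quasi_concave (R : realType) (phi : nat -> R) : Prop :=
  [/\ phi 0 = 0,
      forall m n, (m <= n)%N -> phi m <= phi n
    & forall m n, (m <= n)%N -> m%:R * phi n <= n%:R * phi m].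

Lemma quasi_concave_subadd (R : realType) (phi : nat -> R) m n :
  quasi_concave phi -> phi (m + n)%N <= phi m + phi n.
Proof.
move=> [phi_0 _ conc]; have [|mn0] := posnP (m + n).
  by move=> /eqP; rewrite addn_eq0 => /andP[/eqP -> /eqP ->]; rewrite phi_0 addr0.
rewrite -(ler_pM2l (_ : 0 < (m + n)%:R)) ?ltr0n // {1}natrD mulrDl mulrDr.
by rewrite lerD // conc // ?leq_addl ?leq_addr.
Qed.

(** Covering [D] up to height [theta] by step functions costs at least
    [theta * phi |D|]: after intersecting with [D], a set of size [m] costs at
    least [m * phi |D| / |D|], and these weights are additive in [m], so that
    summing the covering inequality over [D] gives the bound. *)
Lemma cover_cost_ge (R : realType) (phi : nat -> R) (D : {fset nat}) (theta : R)
    (ts : seq (R * {fset nat})) :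
  quasi_concave phi ->
  (forall i, i \in D -> theta <= \sum_(p <- ts) `|p.1| * (i \in p.2)%:R) ->
  theta * phi #|` D| <= \sum_(p <- ts) `|p.1| * phi #|` p.2|.
Proof.
move=> [phi_0 mono conc] cover.
have ge0 n : 0 <= phi n by rewrite -phi_0 mono.
have [->|D0] := eqVneq D fset0.
  by rewrite cardfs0 phi_0 mulr0 sumr_ge0 // => p _; rewrite mulr_ge0.
have d0 : 0 < #|` D|%:R :> R by rewrite ltr0n cardfs_gt0.
rewrite -(ler_pM2l d0) mulrA.
have -> : #|` D|%:R * theta = \sum_(i <- D) theta.
  by rewrite big_const_seq count_predT iter_addr_0 mulr_natl.
rewrite mulr_suml.
apply: (@le_trans _ _ (\sum_(i <- D)
    (\sum_(p <- ts) `|p.1| * (i \in p.2)%:R) * phi #|` D|)).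
  rewrite big_seq [leRHS]big_seq; apply: ler_sum => i iD.
  by rewrite ler_wpM2r // cover.
under eq_bigr do rewrite mulr_suml.
rewrite exchange_big /= mulr_sumr; apply: ler_sum => p _.
under eq_bigr do rewrite -mulrA.
rewrite -mulr_sumr mulrCA ler_wpM2l // -mulr_suml.
have -> : \sum_(i <- D) ((i \in p.2)%:R : R) =
    #|` [fset i in D | i \in p.2]%fset|%:R.
  by rewrite -natr_sum -big_mkcond /= big_fset_condE /= sum1_size.
apply: (le_trans (conc _ _ _)).
  by apply: fsubset_leq_card; apply/fsubsetP => i; rewrite !inE => /andP[].
rewrite ler_wpM2l // mono //.
by apply: fsubset_leq_card; apply/fsubsetP => i; rewrite !inE => /andP[].
Qed.

(** * The fundamental function of a democratic basis *)

Section Fundamental.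
Context (R : realType) (X : normedModType R) (e : nat -> X) (D : R).
Context (democr : D_democratic (fun x : X => `|x|) e D).

Lemma norm_seq_le (s : seq nat) (B : {fset nat}) : uniq s ->
  (size s <= #|` B|)%N -> `|\sum_(i <- s) e i| <= D * `|\sum_(i <- B) e i|.
Proof.
move=> us sB; have ps : perm_eq [fset x in s]%fset s.
  by apply: uniq_perm => // i; rewrite !inE.
rewrite -(perm_big _ ps) /=; apply: (proj2 democr).
by rewrite (perm_size ps).
Qed.

(** Cut [A] into consecutive blocks of size [|B|] and apply democracy to each;
    there are at most [|A| / |B| + 1] of them. *)
Lemma norm_fset_le_card (A B : {fset nat}) :
  #|` B|%:R * `|\sum_(i <- A) e i| <=
  D * (#|` A| + #|` B|)%:R * `|\sum_(i <- B) e i|.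
Proof.
have D0 : 0 <= D by rewrite (le_trans ler01) //; case: democr.
have [->|B0] := eqVneq B fset0.
  by rewrite cardfs0 mul0r !mulr_ge0.
have {B0} b0 : (0 < #|` B|)%N by rewrite cardfs_gt0.
set b := #|` B| in b0 *; set N := `|\sum_(i <- B) e i|.
have N0 : 0 <= N by exact: normr_ge0.
suff H n (s : seq nat) : (size s <= n)%N -> uniq s ->
    b%:R * `|\sum_(i <- s) e i| <= D * (size s + b)%:R * N.
  exact: (H _ _ (leqnn _) (fset_uniq A)).
elim: n s => [|n IHn] s sn us.
  by move: sn; rewrite leqn0 size_eq0 => /eqP ->;
    rewrite big_nil normr0 mulr0 !mulr_ge0.
have [sb|bs] := leqP (size s) b.
  have := norm_seq_le us sb; rewrite -/N => le_s.
  rewrite (le_trans (ler_wpM2l (ler0n _ b) le_s)) // natrD.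
  have : 0 <= D * (size s)%:R * N by rewrite !mulr_ge0.
  by rewrite mulrDr mulrDl; lra.
have /IHn -/(_ (drop_uniq b us)) : (size (drop b s) <= n)%N.
  by rewrite size_drop; lia.
have := @norm_seq_le (take b s) B (take_uniq b us).
rewrite size_take bs leqnn => /(_ isT); rewrite -/N size_drop.
rewrite subnK ?(ltnW bs) // => le_take le_drop.
rewrite -{1}(cat_take_drop b s) big_cat /=.
have bR : 0 <= b%:R :> R by [].
rewrite (le_trans (ler_wpM2l bR (ler_normD _ _))) //.
have := ler_wpM2l bR le_take; rewrite natrD; nra.
Qed.

(** On [n > 0], the greatest function below [|1_B|] at [n = |B|], for all
    nonempty [B], that is nondecreasing with [n |-> fundamental n / n]
    nonincreasing: each factor [max 1 (n / |B|)] has these two properties, and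
    they survive the infimum. *)
Definition fundamental (n : nat) : R :=
  if n == 0 then 0 else
  inf [set Num.max 1 (n%:R / #|` B|%:R) * `|\sum_(i <- B) e i|
      | B in [set B : {fset nat} | B != fset0]].

Lemma fundamental_le n (B : {fset nat}) : B != fset0 ->
  fundamental n <= Num.max 1 (n%:R / #|` B|%:R) * `|\sum_(i <- B) e i|.
Proof.
move=> B0; rewrite /fundamental; case: ifP => _.
  by rewrite mulr_ge0 // le_max ler01.
apply: ge_inf; last by exists B.
by exists 0 => _ [A _ <-]; rewrite mulr_ge0 // le_max ler01.
Qed.

Lemma fundamental_ge n r : (0 < n)%N ->
  (forall B : {fset nat}, B != fset0 ->
    r <= Num.max 1 (n%:R / #|` B|%:R) * `|\sum_(i <- B) e i|) ->
  r <= fundamental n.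
Proof.
rewrite /fundamental lt0n => /negPf -> rle; apply: lb_le_inf; last first.
  by move=> _ [B B0 <-]; exact: rle.
exists (Num.max 1 (n%:R / #|` [fset 0%N]%fset|%:R) *
  `|\sum_(i <- [fset 0%N]%fset) e i|).
by exists [fset 0%N]%fset => //=; rewrite -cardfs_gt0 cardfs1.
Qed.

End Fundamental.

(** Nothing is lost, up to constants, in passing from [|1_B|] to its
    quasi-concave minorant: by [norm_fset_le_card], enlarging a set from [|B|]
    to [n] elements increases the norm at most by a multiple of
    [max 1 (n / |B|)]. *)
Lemma exists_quasi_concave_fundamental (R : realType) (X : normedModType R)
    (e : nat -> X) D :
  D_democratic (fun x : X => `|x|) e D -> e 0 != 0 ->
  exists (phi : nat -> R) (c1 c2 : R),
    [/\ quasi_concave phi, phi 1 = 1,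
       forall B : {fset nat}, phi #|` B| <= c1 * `|\sum_(i <- B) e i|
     & forall B : {fset nat}, `|\sum_(i <- B) e i| <= c2 * phi #|` B|].
Proof.
move=> democr e0; have D1 := proj1 democr.
have lo (A : {fset nat}) :
    `|\sum_(i <- A) e i| <= 2 * D * fundamental e #|` A|.
  have [->|A0] := eqVneq A fset0.
    by rewrite cardfs0 big_seq_fset0 normr0 /fundamental eqxx mulr0.
  rewrite mulrC -ler_pdivrMr; last lra.
  apply: fundamental_ge => [|B B0]; first by rewrite cardfs_gt0.
  have b0 : 0 < #|` B|%:R :> R by rewrite ltr0n cardfs_gt0.
  have := norm_fset_le_card democr A B.
  rewrite natrD; set b := #|` B|%:R in b0 *; set a := #|` A|%:R.
  set N := `|\sum_(i <- A) e i|; set M := `|\sum_(i <- B) e i|.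
  have M0 : 0 <= M by exact: normr_ge0.
  move=> le_N; rewrite ler_pdivrMr; last lra.
  have {}le_N : N <= D * M * (a / b + 1).
    rewrite -(ler_pM2l b0) (le_trans le_N) // le_eqVlt; apply/orP; left; apply/eqP.
    by field; lra.
  have DM0 : 0 <= D * M by rewrite mulr_ge0 // (le_trans _ D1).
  have le_max : a / b + 1 <= 2 * Num.max 1 (a / b).
    by case: (leP 1 (a / b)) => ?; lra.
  rewrite (le_trans le_N) // (le_trans (ler_wpM2l DM0 le_max)) //.
  by rewrite le_eqVlt; apply/orP; left; apply/eqP; ring.
have ge0 n : 0 <= fundamental e n.
  have [->|n0] := posnP n; first by rewrite /fundamental eqxx.
  by apply: fundamental_ge => // B _; rewrite mulr_ge0 // le_max ler01.
have mono m n : (m <= n)%N -> fundamental e m <= fundamental e n.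
  have [->|n0] := posnP n; first by rewrite leqn0 => /eqP ->.
  move=> mn; apply: fundamental_ge => // B B0.
  apply: (le_trans (fundamental_le e m B0)).
  by rewrite ler_wpM2r // ge_max !le_max lexx /= ler_wpM2r ?orbT ?ler_nat.
have conc m n : (m <= n)%N -> m%:R * fundamental e n <= n%:R * fundamental e m.
  have [->|m0] := posnP m; first by rewrite mul0r mulr_ge0.
  move=> mn; have n0 : 0 < n%:R :> R by rewrite ltr0n (leq_trans m0).
  rewrite -ler_pdivrMl //; apply: fundamental_ge => // B B0.
  have b0 : 0 < #|` B|%:R :> R by rewrite ltr0n cardfs_gt0.
  have := fundamental_le e n B0.
  set b := #|` B|%:R in b0 *; set M := `|_|; set p := fundamental e n => le_p.
  have M0 : 0 <= M by exact: normr_ge0.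
  have mn1 : m%:R <= n%:R :> R by rewrite ler_nat.
  rewrite ler_pdivrMl // (le_trans (ler_wpM2l (ler0n _ m) le_p)) //.
  rewrite !mulrA ler_wpM2r //.
  rewrite !maxr_pMr ?ler0n // !mulr1 ge_max !le_max mn1 /=.
  by rewrite mulrCA lexx orbT.
have phi01 : 0 < fundamental e 1.
  have := lo [fset 0%N]%fset; rewrite cardfs1 big_seq_fset1 => le_e0.
  rewrite -(pmulr_rgt0 _ (_ : 0 < 2 * D)); last lra.
  by rewrite (lt_le_trans _ le_e0) // normr_gt0.
exists (fun n => fundamental e n / fundamental e 1), (fundamental e 1)^-1,
  (2 * D * fundamental e 1); split.
- have phiV0 : 0 <= (fundamental e 1)^-1 by rewrite invr_ge0.
  split=> [|m n mn|m n mn]; first by rewrite /fundamental eqxx mul0r.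
    by rewrite ler_wpM2r // mono.
  by rewrite !mulrA ler_wpM2r // conc.
- by rewrite divff // gt_eqF.
- move=> B; rewrite mulrC ler_wpM2l ?invr_ge0 //.
  have [->|B0] := eqVneq B fset0; first by rewrite cardfs0 /fundamental eqxx.
  have b0 : #|` B|%:R != 0 :> R by rewrite pnatr_eq0 -lt0n cardfs_gt0.
  by have := fundamental_le e #|` B| B0; rewrite divff // maxxx mul1r.
- move=> B; rewrite mulrA mulrAC -[_ * fundamental e 1 * _]mulrA divff ?gt_eqF //.
  by rewrite mulr1.
Qed.

(** * The new norm *)

Section Renorming.
Context (R : realType) (X : normedModType R) (e : nat -> X).
Context (coef : X -> nat -> R).
Context (coefP : forall x, expansion e (coef x) x).
Context (coef_uniq : forall a x, expansion e a x -> a = coef x).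
Context (K : R).
Context (unc : K_unconditional (fun x : X => `|x|) e K).
Context (phi : nat -> R) (c1 c2 : R).
Context (phi_qc : quasi_concave phi).
Context (phi_1 : phi 1 = 1).
Context (phi_le_norm :
  forall B : {fset nat}, phi #|` B| <= c1 * `|\sum_(i <- B) e i|).
Context (norm_le_phi :
  forall B : {fset nat}, `|\sum_(i <- B) e i| <= c2 * phi #|` B|).
Context (C : R).
Context (C_gt0 : 0 < C).

(** [s.1] lists the vectors [y_j] and [s.2] the pairs [(t_k, E_k)]. *)
Definition dominates (a : nat -> R) (s : seq X * seq (R * {fset nat})) : Prop :=
  forall i, `|a i| <= \sum_(y <- s.1) `|coef y i| +
                      \sum_(p <- s.2) `|p.1| * (i \in p.2)%:R.

Definition cost (s : seq X * seq (R * {fset nat})) : R :=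
  C * \sum_(y <- s.1) `|y| + \sum_(p <- s.2) `|p.1| * phi #|` p.2|.

Definition renorm (x : X) : R := inf [set cost s | s in dominates (coef x)].

Lemma phi_ge0 n : 0 <= phi n.
Proof. by have [phi_0 mono _] := phi_qc; rewrite -phi_0 mono. Qed.

Lemma cost_ge0 s : 0 <= cost s.
Proof.
apply: addr_ge0; first by rewrite mulr_ge0 ?sumr_ge0 // ltW.
by apply: sumr_ge0 => p _; rewrite mulr_ge0 ?phi_ge0.
Qed.

Lemma renorm_le x s : dominates (coef x) s -> renorm x <= cost s.
Proof.
move=> dom; apply: ge_inf; last by exists s.
by exists 0 => _ [t _ <-]; exact: cost_ge0.
Qed.

Lemma dominates_self x : dominates (coef x) ([:: x], [::]).
Proof. by move=> i; rewrite big_seq1 big_nil addr0. Qed.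

Lemma renorm_ge x r :
  (forall s, dominates (coef x) s -> r <= cost s) -> r <= renorm x.
Proof.
move=> r_le; apply: lb_le_inf; last by move=> _ [s dom <-]; exact: r_le.
by exists (cost ([:: x], [::])); exists ([:: x], [::]) => //; exact: dominates_self.
Qed.

Lemma renorm_le_norm x : renorm x <= C * `|x|.
Proof.
rewrite (le_trans (renorm_le (@dominates_self x))) //.
by rewrite /cost big_seq1 big_nil addr0.
Qed.

Lemma renorm_mono x y :
  (forall i, `|coef x i| <= `|coef y i|) -> renorm x <= renorm y.
Proof.
move=> xy; apply: renorm_ge => s dom; apply: renorm_le => i.
exact: le_trans (xy i) (dom i).
Qed.

Lemma renormD x y : renorm (x + y) <= renorm x + renorm y.
Proof.
rewrite -lerBlDr; apply: renorm_ge => s doms.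
rewrite lerBlDr -lerBlDl; apply: renorm_ge => t domt.
rewrite lerBlDl.
have -> : cost s + cost t = cost (s.1 ++ t.1, s.2 ++ t.2).
  by rewrite /cost /= !big_cat /=; ring.
apply: renorm_le => i; rewrite (coefD coefP coef_uniq) !big_cat /=.
by rewrite (le_trans (ler_normD _ _)) // addrACA lerD.
Qed.

Lemma renormZ_le c x : renorm (c *: x) <= `|c| * renorm x.
Proof.
have [->|c0] := eqVneq c 0.
  rewrite normr0 mul0r (le_trans (renorm_le_norm _)) //.
  by rewrite scale0r normr0 mulr0.
have nc0 : 0 < `|c| by rewrite normr_gt0.
rewrite -ler_pdivrMl //; apply: renorm_ge => s dom.
rewrite ler_pdivrMl //.
have -> : `|c| * cost s =
    cost ([seq c *: y | y <- s.1], [seq (c * p.1, p.2) | p <- s.2]).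
  rewrite /cost /= !big_map mulrDr mulrCA !mulr_sumr; congr (_ + _).
    by apply: eq_bigr => y _; rewrite normrZ.
  by apply: eq_bigr => p _ /=; rewrite normrM mulrA.
apply: renorm_le => i; rewrite (coefZ coefP coef_uniq) normrM /= !big_map.
rewrite (le_trans (ler_wpM2l (normr_ge0 c) (dom i))) // mulrDr !mulr_sumr.
rewrite le_eqVlt; apply/orP; left; apply/eqP; congr (_ + _).
  by apply: eq_bigr => y _; rewrite (coefZ coefP coef_uniq) normrM.
by apply: eq_bigr => p _ /=; rewrite normrM mulrA.
Qed.

Lemma renormZ c x : renorm (c *: x) = `|c| * renorm x.
Proof.
have [->|c0] := eqVneq c 0.
  apply/eqP; rewrite eq_le renormZ_le normr0 mul0r /=.
  by apply: renorm_ge => s _; exact: cost_ge0.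
apply/eqP; rewrite eq_le renormZ_le /= -ler_pdivlMl ?normr_gt0 //.
by rewrite -normfV -{1}(scalerK c0 x) renormZ_le.
Qed.

Lemma basis_norm_ge i : 1 <= c1 * `|e i|.
Proof.
by have := phi_le_norm [fset i]%fset; rewrite big_seq_fset1 cardfs1 phi_1.
Qed.

Lemma basis_norm_gt0 i : 0 < `|e i|.
Proof.
rewrite lt_neqAle normr_ge0 andbT eq_sym; apply/eqP => ei0.
by have := basis_norm_ge i; rewrite ei0 mulr0 ler10.
Qed.

Lemma c1_gt0 : 0 < c1.
Proof.
by rewrite -(pmulr_lgt0 _ (basis_norm_gt0 0)) (lt_le_trans ltr01 (basis_norm_ge 0)).
Qed.

Lemma c2_gt0 : 0 < c2.
Proof.
have := norm_le_phi [fset 0%N]%fset; rewrite big_seq_fset1 cardfs1 phi_1 mulr1.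
exact: lt_le_trans (basis_norm_gt0 0).
Qed.

Lemma K_gt0 : 0 < K.
Proof.
rewrite -(pmulr_lgt0 _ (basis_norm_gt0 0)) (lt_le_trans (basis_norm_gt0 0)) //.
exact: (norm_le_coef coefP unc).
Qed.

(** The step functions of a decomposition are themselves vectors of [X], so
    that the whole decomposition is an instance of [norm_dominated]. *)
Lemma norm_le_renorm x : `|x| <= K * (C^-1 + c2) * renorm x.
Proof.
have M_gt0 : 0 < K * (C^-1 + c2).
  by rewrite mulr_gt0 ?addr_gt0 ?invr_gt0 ?K_gt0 ?c2_gt0.
rewrite -ler_pdivrMl //; apply: renorm_ge => s dom; rewrite ler_pdivrMl //.
set Y := \sum_(y <- s.1) `|y|; set T := \sum_(p <- s.2) `|p.1| * phi #|` p.2|.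
have le_x : `|x| <= K * (Y + c2 * T).
  pose ys := s.1 ++ [seq p.1 *: \sum_(i <- p.2) e i | p : R * {fset nat} <- s.2].
  have := @norm_dominated _ _ _ _ coefP coef_uniq _ unc x ys.
  rewrite !big_cat /= !big_map => /(_ _)/le_trans; apply.
    move=> i; rewrite big_cat big_map /= (le_trans (dom i)) // lerD2l.
    apply: ler_sum => p _.
    by rewrite (coefZ coefP coef_uniq) (coef_fset coefP coef_uniq) normrM normr_nat.
  rewrite ler_pM2l ?K_gt0 // lerD2l mulr_sumr; apply: ler_sum => p _.
  by rewrite normrZ mulrCA ler_wpM2l.
rewrite (le_trans le_x) // -mulrA ler_pM2l ?K_gt0 // /cost -/Y -/T.
have -> : (C^-1 + c2) * (C * Y + T) = Y + c2 * T + (c2 * C * Y + C^-1 * T).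
  by field; rewrite gt_eqF.
rewrite lerDl addr_ge0 // !mulr_ge0 ?invr_ge0 ?(ltW c2_gt0) ?(ltW C_gt0) ?sumr_ge0 //.
by move=> p _; rewrite mulr_ge0 // phi_ge0.
Qed.

Lemma renorm_fset_le (B : {fset nat}) : renorm (\sum_(i <- B) e i) <= phi #|` B|.
Proof.
have -> : phi #|` B| = cost ([::], [:: (1, B)]).
  by rewrite /cost big_nil big_seq1 normr1 mulr0 add0r mul1r.
apply: renorm_le => i; rewrite big_nil big_seq1 normr1 add0r mul1r /=.
by rewrite (coef_fset coefP coef_uniq) ger0_norm.
Qed.

(** In a decomposition of [e i], a step function costs at least its height at
    [i], since [phi |E| >= phi 1 = 1] when [i] is in [E]; and a vector [y] costs
    at least [|coef y i|] as soon as [C] is large. *)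
Lemma renorm_basis i : c1 * K <= C -> renorm (e i) = 1.
Proof.
move=> le_C; apply/eqP; rewrite eq_le; apply/andP; split.
  by have := renorm_fset_le [fset i]%fset; rewrite big_seq_fset1 cardfs1 phi_1.
have [_ mono _] := phi_qc.
apply: renorm_ge => s /(_ i); rewrite (coef_basis coef_uniq) eqxx normr1.
move=> /le_trans; apply; rewrite lerD //.
  rewrite mulr_sumr; apply: ler_sum => y _.
  rewrite (le_trans _ (ler_wpM2r (normr_ge0 y) le_C)) //.
  have le_y : `|coef y i *: e i| <= K * `|y|.
    apply: (norm_le_coef coefP unc) => j.
    rewrite (coefZ coefP coef_uniq) (coef_basis coef_uniq).
    by case: eqP => [->|_]; rewrite ?mulr1 // mulr0 normr0.
  rewrite -mulrA (le_trans _ (ler_wpM2l (ltW c1_gt0) le_y)) //.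
  by rewrite normrZ mulrCA ler_peMr // basis_norm_ge.
apply: ler_sum => p _; rewrite ler_wpM2l //.
case: (boolP (i \in p.2)) => [ip|_]; last exact: phi_ge0.
by rewrite -phi_1 mono // cardfs_gt0; apply/fset0Pn; exists i.
Qed.

(** Where the vectors of a decomposition are not small ([big_part]), they pay
    for [phi |big_part|] since [C] is large; elsewhere the step functions have
    to pay, by [cover_cost_ge]. Both parts may be empty, which is why
    [phi 0 = 0] matters. *)
Lemma renorm_fset_ge (B : {fset nat}) eta : 0 < eta < 1 ->
  c1 * K <= eta * C ->
  (1 - eta) * phi #|` B| <= renorm (\sum_(i <- B) e i).
Proof.
move=> /andP[eta0 eta1] le_C.
apply: renorm_ge => s dom.
pose u i := \sum_(y <- s.1) `|coef y i|.
pose big_part := [fset i in B | eta <= u i]%fset.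
pose rest := [fset i in B | u i < eta]%fset.
have card_B : #|` B| = (#|` big_part| + #|` rest|)%N.
  rewrite -(cardfsID big_part B).
  have -> : (B `&` big_part)%fset = big_part.
    by apply/fsetP => i; rewrite !inE; case: (i \in B).
  have -> // : (B `\` big_part)%fset = rest.
  by apply/fsetP => i; rewrite !inE ltNge; case: (i \in B); rewrite ?andbF ?andbT.
have le_big : eta * `|\sum_(i <- big_part) e i| <= K * \sum_(y <- s.1) `|y|.
  rewrite -{1}(gtr0_norm eta0) -normrZ.
  apply: (norm_dominated coefP coef_uniq unc) => i.
  rewrite (coefZ coefP coef_uniq) (coef_fset coefP coef_uniq) !inE.
  case: (i \in B) => /=; last by rewrite mulr0 normr0 sumr_ge0.
  case: (leP eta (u i)) => [le_u|_]; last by rewrite mulr0 normr0 sumr_ge0.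
  by rewrite mulr1 gtr0_norm.
have le_rest : (1 - eta) * phi #|` rest| <= \sum_(p <- s.2) `|p.1| * phi #|` p.2|.
  apply: cover_cost_ge => // i; rewrite inE => /andP[iB ltu].
  have := dom i; rewrite (coef_fset coefP coef_uniq) iB normr1 -/(u i); lra.
have := quasi_concave_subadd #|` big_part| #|` rest| phi_qc; rewrite -card_B.
rewrite /cost; move: le_big le_rest (phi_le_norm big_part) (phi_ge0 #|` big_part|).
set N := `|_|; set Y := \sum_(y <- s.1) `|y|; set T := \sum_(p <- s.2) _.
set phi_big := phi #|` big_part| => le_big le_rest le_N big_ge0 subadd.
have Y0 : 0 <= Y by exact: sumr_ge0.
have big_le : phi_big <= C * Y.
  rewrite -(ler_pM2l eta0) (le_trans (ler_wpM2l (ltW eta0) le_N)) //.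
  rewrite mulrCA (le_trans (ler_wpM2l (ltW c1_gt0) le_big)) // !mulrA.
  exact: ler_wpM2r.
have eta1' : 0 <= 1 - eta by lra.
rewrite (le_trans (ler_wpM2l eta1' subadd)) // mulrDr lerD //.
rewrite (le_trans _ big_le) // ler_piMl //; lra.
Qed.

End Renorming.

Unset Implicit Arguments.

(* World: MathComp-Analysis *)
Theorem theorem2 (R : realType) (X : completeNormedModType R) (e : nat -> X)
    (basis_e : schauder_basis e)
    (seminorm_e : seminormalized (fun x : X => `|x|) e)
    (uncond_e : unconditional (fun x : X => `|x|) e)
    (democr_e : democratic (fun x : X => `|x|) e)
    (eps : R) (eps_gt0 : 0 < eps) :
  exists N : X -> R,
    [/\ equivalent_norm N,
        normalized N e,
        K_unconditional N e 1
      & D_democratic N e (1 + eps)].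
Proof.
have [K unc] := uncond_e; have [D democr] := democr_e.
have [coef coefP] := choice basis_e.
have coef_exp x : expansion e (coef x) x by have [] := coefP x.
have coef_uniq a x : expansion e a x -> a = coef x.
  by move=> ax; have [_ uniq_x] := coefP x; rewrite (uniq_x a).
have e0 : e 0 != 0.
  have [inf_gt0 _] := seminorm_e; apply/eqP => e0; move: inf_gt0.
  apply/negP; rewrite -leNgt; apply: ereal_inf_lbound.
  by exists 0%N => //; rewrite e0 normr0.
have [phi [c1 [c2 [qc phi1 up lo]]]] := exists_quasi_concave_fundamental democr e0.
have K0 := K_gt0 coef_exp unc phi1 up.
have c1_gt := c1_gt0 phi1 up.
have c2_gt := c2_gt0 phi1 up lo.
(* so that [(1 - eta)^-1 = 1 + eps] *)
pose eta := eps / (1 + eps).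
have eta_prop : 0 < eta < 1.
  by rewrite divr_gt0 ?addr_gt0 //= ltr_pdivrMr ?addr_gt0 // mul1r ltrDr.
have /andP[eta0 eta1] := eta_prop.
pose C := c1 * K / eta.
have C0 : 0 < C by rewrite divr_gt0 // mulr_gt0.
have etaC : eta * C = c1 * K by rewrite /C; field; lra.
have leC : c1 * K <= C by rewrite -etaC ler_piMl // ltW.
pose N := renorm coef phi C.
have basisN i : N (e i) = 1.
  exact: (renorm_basis coef_exp coef_uniq unc qc phi1 up C0).
have equivN x : `|x| <= K * (C^-1 + c2) * N x.
  exact: (norm_le_renorm coef_exp coef_uniq unc qc phi1 up lo).
have M0 : 0 < K * (C^-1 + c2) by rewrite mulr_gt0 ?addr_gt0 ?invr_gt0.
exists N; split.
- split; first split.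
  + move=> x Nx0; apply/eqP; rewrite -normr_le0.
    by rewrite (le_trans (equivN x)) // Nx0 mulr0.
  + exact: renormZ.
  + exact: renormD.
  exists (K * (C^-1 + c2))^-1, C; split => // [|x]; first by rewrite invr_gt0.
  by rewrite ler_pdivrMl //; split=> //; exact: renorm_le_norm.
- exact: basisN.
- move=> a b x y /coef_uniq -> /coef_uniq -> ab.
  by rewrite mul1r; exact: renorm_mono.
- split=> [|A B AB]; first by rewrite lerDl ltW.
  have [_ mono _] := qc.
  have leA : N (\sum_(i <- A) e i) <= phi #|` A|.
    exact: (renorm_fset_le coef_exp coef_uniq).
  have leB : (1 - eta) * phi #|` B| <= N (\sum_(i <- B) e i).
    apply: (renorm_fset_ge coef_exp coef_uniq unc qc phi1 up) => //.
    by rewrite etaC.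
  rewrite (le_trans leA) // (le_trans (mono _ _ AB)) //.
  have -> : phi #|` B| = (1 + eps) * ((1 - eta) * phi #|` B|).
    by rewrite /eta; field; lra.
  by rewrite ler_wpM2l // addr_ge0 // ltW.
Qed.
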